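(* For every integer $n\ge 1$, we have $\rho_n(\check{\mathfrak{H}}^1)\subset\ker Z$.
   Context: Let $\mathfrak{H}=\mathbb{Q}\langle x,y\rangle$ be the non-commutative polynomial algebra over $\mathbb{Q}$ in two indeterminates $x,y$, and put $z=x+y$. Let $\mathfrak{H}^1=\mathbb{Q}+\mathfrak{H}y$ and $\mathfrak{H}^0=\mathbb{Q}+x\mathfrak{H}y$. Let $\check{\mathfrak{H}}^1$ be the $\mathbb{Q}$-subspace of $\mathfrak{H}^1$ spanned by all words (monomials in $x,y$) of $\mathfrak{H}^1$ other than powers of $y$ (with $1=y^0$ counted as a power of $y$). For integers $k_1>1$, $k_2,\ldots,k_m\ge 1$, the multiple zeta value is $\zeta(k_1,\ldots,k_m)=\sum_{m_1>m_2>\cdots>m_m>0}\frac{1}{m_1^{k_1}\cdots m_m^{k_m}}$. The $\mathbb{Q}$-linear map $Z\colon\mathfrak{H}^0\to\mathbb{R}$ is defined by $Z(1)=1$ and $Z(x^{k_1-1}yx^{k_2-1}y\cdots x^{k_m-1}y)=\zeta(k_1,k_2,\ldots,k_m)$. For $n\ge 1$, $\mathfrak{H}$ acts on $\mathfrak{H}^{\otimes(n+1)}$ (tensor over $\mathbb{Q}$) on the left and right by $a\diamond(w_1\otimes\cdots\otimes w_{n+1})=w_1\otimes\cdots\otimes w_n\otimes aw_{n+1}$ and $(w_1\otimes\cdots\otimes w_{n+1})\diamond b=w_1b\otimes w_2\otimes\cdots\otimes w_{n+1}$, which is a bimodule structure. The $\mathbb{Q}$-linear map $\mathcal{C}_n\colon\mathfrak{H}\to\mathfrak{H}^{\otimes(n+1)}$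 is the one determined by $\mathcal{C}_n(x)=x\otimes z^{\otimes(n-1)}\otimes y$, $\mathcal{C}_n(y)=-(x\otimes z^{\otimes(n-1)}\otimes y)$ and $\mathcal{C}_n(ww')=\mathcal{C}_n(w)\diamond w'+w\diamond\mathcal{C}_n(w')$ for all $w,w'\in\mathfrak{H}$ (so $\mathcal{C}_n(1)=0$). Let $M_n\colon\mathfrak{H}^{\otimes(n+1)}\to\mathfrak{H}$ be the multiplication map $w_1\otimes\cdots\otimes w_{n+1}\mapsto w_1\cdots w_{n+1}$, and set $\rho_n=M_n\mathcal{C}_n\colon\mathfrak{H}\to\mathfrak{H}$; its image lies in $x\mathfrak{H}y$. *)

(* Defs.v *)
From HB Require Import structures.
From mathcomp Require Import all_boot all_order all_algebra finmap.
From mathcomp.multinomials Require Import monalg.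
From mathcomp Require Import boolp classical_sets reals topology normedtype.
From mathcomp Require Import sequences.

Set Implicit Arguments.
Unset Strict Implicit.
Unset Printing Implicit Defensive.

Import Order.TTheory GRing.Theory Num.Theory.
Import numFieldNormedType.Exports.
Local Open Scope classical_set_scope.
Local Open Scope ring_scope.

Section LinearExtension.
Context (K : choiceType) (V : lmodType rat).
Implicit Types (f : K -> V) (g : {malg rat[K]}) (c : rat).

Definition linext f g : V := \sum_(k <- msupp g) g@_k *: f k.

Lemma linextEw (d : {fset K}) f g : (msupp g `<=` d)%fset ->
  linext f g = \sum_(k <- d) g@_k *: f k.
Proof.
move=> le; rewrite /linext (big_fset_incl _ le) //= => k _ /mcoeff_outdom ->.
by rewrite scale0r.
Qed.

Lemma linext_is_linear f : linear (linext f).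
Proof.
move=> c g1 g2; pose d := (msupp g1 `|` msupp g2)%fset.
have le1 : (msupp g1 `<=` d)%fset by exact: fsubsetUl.
have le2 : (msupp g2 `<=` d)%fset by exact: fsubsetUr.
have le : (msupp (c *: g1 + g2) `<=` d)%fset.
  by apply: (fsubset_trans (msuppD_le _ _)); exact: fsetSU (msuppZ_le _ _).
rewrite (linextEw _ le1) (linextEw _ le2) (linextEw _ le) scaler_sumr -big_split.
by apply: eq_bigr => k _; rewrite mcoeffD mcoeffZ scalerDl scalerA.
Qed.

HB.instance Definition _ f :=
  GRing.isLinear.Build rat {malg rat[K]} V *:%R (linext f) (linext_is_linear f).

Lemma linextU f k : linext f << k >> = f k.
Proof. by rewrite /linext msuppU oner_eq0 big_seq_fset1 mcoeffUU scale1r. Qed.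

Lemma linext_addf f1 f2 g :
  linext (fun k => f1 k + f2 k) g = linext f1 g + linext f2 g.
Proof. by rewrite -big_split; apply: eq_bigr => k _; rewrite scalerDr. Qed.

Lemma linext_scalef c f g : linext (fun k => c *: f k) g = c *: linext f g.
Proof.
by rewrite scaler_sumr; apply: eq_bigr => k _; rewrite !scalerA mulrC.
Qed.

End LinearExtension.

Lemma basis_scale (K : choiceType) (a : rat) (k : K) :
  << a *g k >> = a *: << k >> :> {malg rat[K]}.
Proof. by apply/malgP => j; rewrite mcoeffZ !mcoeffU mulr_natr. Qed.

Lemma malg_basis_ind (K : choiceType) (P : {malg rat[K]} -> Prop) :
  P 0 -> (forall c k g, P g -> P (c *: << k >> + g)) -> forall g, P g.
Proof.
move=> P0 PD g; rewrite [g]monalgE; elim/big_rec: _ => // k h _ /PD.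
by rewrite basis_scale.
Qed.

Lemma malg_linear_ext (K : choiceType) (V : lmodType rat)
    (f g : {malg rat[K]} -> V) :
  linear f -> linear g -> (forall k, f << k >> = g << k >>) -> f =1 g.
Proof.
move=> lf lg fg; have lin0 h : linear h -> h 0 = 0 :> V.
  move=> lh; have /= := lh (-1) 0 0.
  by rewrite scaler0 addr0 [X in _ = X + _]scaleN1r addNr.
elim/malg_basis_ind => [|c k h IH]; first by rewrite !lin0.
by rewrite lf lg fg IH.
Qed.

Section BilinearExtension.
Context (K1 K2 K3 : choiceType) (f : K1 -> K2 -> K3).
Implicit Types (g : {malg rat[K1]}) (h : {malg rat[K2]}) (c : rat).

Definition bilext g h : {malg rat[K3]} :=
  linext (fun k1 => linext (fun k2 => << f k1 k2 >>) h) g.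

Lemma bilextU k1 k2 : bilext << k1 >> << k2 >> = << f k1 k2 >>.
Proof. by rewrite /bilext !linextU. Qed.

Lemma bilextl c g1 g2 h :
  bilext (c *: g1 + g2) h = c *: bilext g1 h + bilext g2 h.
Proof. exact: linearP. Qed.

Lemma bilextr c g h1 h2 :
  bilext g (c *: h1 + h2) = c *: bilext g h1 + bilext g h2.
Proof.
rewrite /bilext -linext_scalef -linext_addf.
by apply: eq_bigr => k _; rewrite linearP.
Qed.

End BilinearExtension.

(* The letter x is encoded by [false] and the letter y by [true]. *)
Definition word := {fmonom bool}.
HB.instance Definition _ := MonomialDef.on word.
Coercion letters (w : word) : seq bool := fmonom_val w.

Definition frakH := {malg rat[word]}.
HB.instance Definition _ := GRing.Lalgebra.on frakH.

Definition mono (w : word) : frakH := << w >>.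

Definition xH : frakH := mono (fmu false).
Definition yH : frakH := mono (fmu true).
Definition zH : frakH := xH + yH.

Definition H1 : set frakH := [set f | exists c h, f = c%:A + h * yH].

Definition H0 : set frakH := [set f | exists c h, f = c%:A + xH * h * yH].

Definition H1check : set frakH :=
  [set f | exists (s : seq word) (c : word -> rat),
    (forall w, w \in s -> H1 (mono w) /\ forall k, mono w <> yH ^+ k) /\
    f = \sum_(w <- s) c w *: mono w].

Lemma frakH_ext (V : lmodType rat) (f g : frakH -> V) :
  linear f -> linear g -> (forall w, f (mono w) = g (mono w)) -> f =1 g.
Proof. exact: malg_linear_ext. Qed.

Lemma mulr_bilext (f g : frakH) : f * g = bilext (@mmul word) f g.
Proof.
rewrite [LHS]malgME; apply: eq_bigr => u _; rewrite scaler_sumr.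
by apply: eq_bigr => v _; rewrite basis_scale scalerA.
Qed.

Lemma mulr_linl c (f1 f2 g : frakH) :
  (c *: f1 + f2) * g = c *: (f1 * g) + f2 * g.
Proof. by rewrite mulrDl scalerAl. Qed.

Lemma mulr_linr c (f g1 g2 : frakH) :
  f * (c *: g1 + g2) = c *: (f * g1) + f * g2.
Proof. rewrite !mulr_bilext; exact: bilextr. Qed.

Lemma mono_mul u v : mono (mmul u v) = mono u * mono v.
Proof. by rewrite mulr_bilext [RHS]bilextU. Qed.

Lemma mono1 : mono mone = 1.
Proof. by []. Qed.

Lemma word_cons b s : FMonom (b :: s) = mmul (fmu b) (FMonom s) :> word.
Proof. by rewrite /mmul /= fmmulE fmuE. Qed.

Lemma word_cat s t : FMonom (s ++ t) = mmul (FMonom s) (FMonom t) :> word.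
Proof. by rewrite /mmul /= fmmulE. Qed.

Section Zeta.
Variable R : realType.

(* The sum of 1 / (m_1^k_1 ... m_r^k_r) over N > m_1 > ... > m_r > 0. *)
Fixpoint zeta_lt (ks : seq nat) (N : nat) : R :=
  if ks is k :: ks' then \sum_(1 <= m < N) (m%:R ^+ k)^-1 * zeta_lt ks' m else 1.

Definition zeta (ks : seq nat) : R := limn (zeta_lt ks).

(* [index_of c s] is the index of the word x^c s; a trailing power of x, which
   does not occur in words of H0, is ignored. *)
Fixpoint index_of (c : nat) (s : seq bool) : seq nat :=
  if s is b :: s' then
    if b then c.+1 :: index_of 0 s' else index_of c.+1 s'
  else [::].

(* Only the values on H0 are meaningful. *)
Definition Z (f : frakH) : R :=
  mmap ratr (fun w : word => zeta (index_of 0 w)) f.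

Definition kerZ : set frakH := [set f | H0 f /\ Z f = 0].

Lemma Z_mono w : Z (mono w) = zeta (index_of 0 w).
Proof. by rewrite [LHS]mmapU /= rmorph1 mul1r. Qed.

Lemma Z_one : Z 1 = 1.
Proof. rewrite -mono1 Z_mono [letters _]fm1 /zeta; exact: lim_cst. Qed.

Lemma Z_word (ks : seq nat) : all (leq 1) ks ->
  Z (\prod_(k <- ks) (xH ^+ k.-1 * yH)) = zeta ks.
Proof.
have xE c : xH ^+ c = mono (FMonom (nseq c false)).
  elim: c => [|c IH]; first by rewrite expr0 -fmoneE.
  by rewrite exprS IH -mono_mul -word_cons.
have -> : \prod_(k <- ks) (xH ^+ k.-1 * yH) =
    mono (FMonom (flatten [seq rcons (nseq k.-1 false) true | k <- ks])).
  elim: ks => [|k s IH]; first by rewrite big_nil -fmoneE.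
  by rewrite big_cons IH xE /yH fmuE -!mono_mul -!word_cat cats1.
move=> ks_gt0; rewrite Z_mono; congr zeta.
elim: ks ks_gt0 => //= k s IH /andP[k_gt0 /IH {}IH].
have idxE c d t : index_of c (rcons (nseq d false) true ++ t) =
    (c + d).+1 :: index_of 0 t.
  by elim: d c => [|d IHd] c /=; rewrite ?addn0 // IHd addSnnS.
by rewrite idxE [index_of _ _]IH add0n prednK.
Qed.

End Zeta.

(* As H is free on the words, its k-th tensor power is free on the k-tuples
   (w_1, ..., w_k) of words, which stand for w_1 (x) ... (x) w_k. *)
Definition tensH k := {malg rat[k.-tuple word]}.
HB.instance Definition _ k := GRing.Lmodule.on (tensH k).

Definition tmono k (t : k.-tuple word) : tensH k := << t >>.

Definition tcons k : frakH -> tensH k -> tensH k.+1 :=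
  bilext (fun (u : word) (t : k.-tuple word) => [tuple of u :: t]).

(* The pure tensor h_1 (x) ... (x) h_k, as h_1 (x) (h_2 (x) ...). *)
Fixpoint tens k : k.-tuple frakH -> tensH k :=
  if k is k'.+1 then fun h => tcons (thead h) (@tens k' [tuple of behead h])
  else fun=> tmono [tuple].

Definition mulT k : tensH k -> frakH :=
  linext (fun t : k.-tuple word => mono (\big[mmul/mone]_(i < k) tnth t i)).

Section Actions.
Variable n : nat.

Definition lactw (u : word) (t : n.+1.-tuple word) : n.+1.-tuple word :=
  [tuple if i == ord_max then mmul u (tnth t i) else tnth t i | i < n.+1].

Definition ractw (t : n.+1.-tuple word) (u : word) : n.+1.-tuple word :=
  [tuple if i == ord0 then mmul (tnth t i) u else tnth t i | i < n.+1].

Definition lact : frakH -> tensH n.+1 -> tensH n.+1 := bilext lactw.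

Definition ract : tensH n.+1 -> frakH -> tensH n.+1 := bilext ractw.

End Actions.

Section Cyclic.
Variable n : nat.

(* x (x) z (x) ... (x) z (x) y, for n > 0 *)
Definition xzy : tensH n.+1 :=
  tens [tuple if i == ord0 then xH else if i == ord_max then yH else zH
       | i < n.+1].

Fixpoint Cword (s : seq bool) : tensH n.+1 :=
  if s is b :: s' then
    ract (if b then - xzy else xzy) (mono (FMonom s')) +
    lact (mono (fmu b)) (Cword s')
  else 0.

(* [C_x], [C_y], [C_mul] and [C_unique] below show that this is the only linear
   map with C(x) = - C(y) = x (x) z (x) ... (x) z (x) y satisfying the Leibniz
   rule for the two actions. *)
Definition C : frakH -> tensH n.+1 := linext (fun w : word => Cword w).

Definition rho (f : frakH) : frakH := mulT (C f).

End Cyclic.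

Lemma tensH_ext k (V : lmodType rat) (f g : tensH k -> V) :
  linear f -> linear g -> (forall t, f (tmono t) = g (tmono t)) -> f =1 g.
Proof. exact: malg_linear_ext. Qed.

Lemma tcons_linl k c h1 h2 (t : tensH k) :
  tcons (c *: h1 + h2) t = c *: tcons h1 t + tcons h2 t.
Proof. exact: bilextl. Qed.

Lemma tcons_linr k c h (t1 t2 : tensH k) :
  tcons h (c *: t1 + t2) = c *: tcons h t1 + tcons h t2.
Proof. exact: bilextr. Qed.

Lemma tcons_mono k u (t : k.-tuple word) :
  tcons (mono u) (tmono t) = tmono [tuple of u :: t].
Proof. exact: bilextU. Qed.

Lemma mulT_lin k c (t1 t2 : tensH k) :
  mulT (c *: t1 + t2) = c *: mulT t1 + mulT t2.
Proof. exact: linext_is_linear. Qed.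

Lemma mulT_mono k (t : k.-tuple word) :
  mulT (tmono t) = mono (\big[mmul/mone]_(i < k) tnth t i).
Proof. exact: linextU. Qed.

Lemma tensE k (h : k.-tuple frakH) (t : k.-tuple word) :
  (tens h)@_t = \prod_(i < k) (tnth h i)@_(tnth t i).
Proof.
have linextE (K K' : choiceType) (f : K -> {malg rat[K']}) g v :
    (linext f g)@_v = \sum_(u <- msupp g) g@_u * (f u)@_v.
  by rewrite /linext raddf_sum; apply: eq_bigr => u _; rewrite /= mcoeffZ.
have pick1 (K : choiceType) (g : {malg rat[K]}) k0 (a : rat) :
    \sum_(u <- msupp g) g@_u * ((u == k0)%:R * a) = g@_k0 * a.
  transitivity (a *: \sum_(u <- msupp g) << g@_u *g u >>)@_k0.
    rewrite mcoeffZ raddf_sum mulr_sumr; apply: eq_bigr => u _ /=.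
    by rewrite mcoeffU mulrA mulrC mulr_natr.
  by rewrite -[X in _ *: X]monalgE mcoeffZ mulrC.
elim: k h t => [|k IH] h t.
  by rewrite big_ord0 (tuple0 t) [LHS]mcoeffUU.
case/tupleP: t => u t; rewrite big_ord_recl [tens h]/= /tcons /bilext linextE.
rewrite [tnth [tuple of u :: t] ord0]tnth0 -/(thead h).
rewrite (eq_bigr (fun u' => (thead h)@_u' *
    ((u' == u)%:R * (tens [tuple of behead h])@_t))); last first.
  move=> u' _; congr (_ * _); rewrite linextE [RHS]mulrC -[RHS]pick1.
  apply: eq_bigr => v _; congr (_ * _); rewrite mcoeffU -natrM mulnb.
  by congr (_ %:R); rewrite -val_eqE /= eqseq_cons andbC -val_eqE.
rewrite pick1 IH; congr (_ * _); apply: eq_bigr => i _.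
by rewrite tnthS; congr (_ @_ _); rewrite !(tnth_nth 0) /= nth_behead.
Qed.

Section BimoduleTheory.
Variable n : nat.
Implicit Types (a b h : frakH) (T : tensH n.+1) (t : n.+1.-tuple word).

Lemma lact_linl c a1 a2 T : lact (c *: a1 + a2) T = c *: lact a1 T + lact a2 T.
Proof. exact: bilextl. Qed.

Lemma lact_linr c a T1 T2 : lact a (c *: T1 + T2) = c *: lact a T1 + lact a T2.
Proof. exact: bilextr. Qed.

Lemma lact_mono u t : lact (mono u) (tmono t) = tmono (lactw u t).
Proof. exact: bilextU. Qed.

Lemma ract_linl c T1 T2 b : ract (c *: T1 + T2) b = c *: ract T1 b + ract T2 b.
Proof. exact: bilextl. Qed.

Lemma ract_linr c T b1 b2 : ract T (c *: b1 + b2) = c *: ract T b1 + ract T b2.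
Proof. exact: bilextr. Qed.

Lemma ract_mono t u : ract (tmono t) (mono u) = tmono (ractw t u).
Proof. exact: bilextU. Qed.

Lemma lactD a T1 T2 : lact a (T1 + T2) = lact a T1 + lact a T2.
Proof. by have := lact_linr 1 a T1 T2; rewrite !scale1r. Qed.

Lemma ractD T1 T2 b : ract (T1 + T2) b = ract T1 b + ract T2 b.
Proof. by have := ract_linl 1 T1 T2 b; rewrite !scale1r. Qed.

Lemma lact0 a : lact a 0 = 0 :> tensH n.+1.
Proof. by apply: (addrI (lact a 0)); rewrite -lactD !addr0. Qed.

Lemma ract0 b : ract 0 b = 0 :> tensH n.+1.
Proof. by apply: (addrI (ract 0 b)); rewrite -ractD !addr0. Qed.

Lemma lact1 T : lact 1 T = T.
Proof.
move: T; apply: tensH_ext => [c T1 T2|c T1 T2|t].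
- exact: lact_linr.
- by [].
rewrite -mono1 lact_mono; congr tmono; apply: eq_from_tnth => i.
by rewrite tnth_mktuple mul1m if_same.
Qed.

Lemma ract1 T : ract T 1 = T.
Proof.
move: T; apply: tensH_ext => [c T1 T2|c T1 T2|t].
- exact: ract_linl.
- by [].
rewrite -mono1 ract_mono; congr tmono; apply: eq_from_tnth => i.
by rewrite tnth_mktuple mulm1 if_same.
Qed.

Lemma lactM a b T : lact (a * b) T = lact a (lact b T).
Proof.
move: T; apply: tensH_ext => [c T1 T2|c T1 T2|t].
- exact: lact_linr.
- by rewrite !lact_linr.
move: b; apply: frakH_ext => [c f g|c f g|v].
- by rewrite mulr_linr lact_linl.
- by rewrite lact_linl lact_linr.
move: a; apply: frakH_ext => [c f g|c f g|u].
- by rewrite mulr_linl lact_linl.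
- by rewrite lact_linl.
rewrite -mono_mul !lact_mono; congr tmono; apply: eq_from_tnth => i.
by rewrite !tnth_mktuple; case: eqP => // _; rewrite mulmA.
Qed.

Lemma ractM a b T : ract T (a * b) = ract (ract T a) b.
Proof.
move: T; apply: tensH_ext => [c T1 T2|c T1 T2|t].
- exact: ract_linl.
- by rewrite !ract_linl.
move: b; apply: frakH_ext => [c f g|c f g|v].
- by rewrite mulr_linr ract_linr.
- by rewrite ract_linr.
move: a; apply: frakH_ext => [c f g|c f g|u].
- by rewrite mulr_linl ract_linr.
- by rewrite ract_linr ract_linl.
rewrite -mono_mul !ract_mono; congr tmono; apply: eq_from_tnth => i.
by rewrite !tnth_mktuple; case: eqP => // _; rewrite mulmA.
Qed.

Lemma lact_ract a b T : lact a (ract T b) = ract (lact a T) b.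
Proof.
move: T; apply: tensH_ext => [c T1 T2|c T1 T2|t].
- by rewrite ract_linl lact_linr.
- by rewrite lact_linr ract_linl.
move: b; apply: frakH_ext => [c f g|c f g|v].
- by rewrite ract_linr lact_linr.
- by rewrite ract_linr.
move: a; apply: frakH_ext => [c f g|c f g|u].
- by rewrite lact_linl.
- by rewrite lact_linl ract_linl.
rewrite ract_mono !lact_mono ract_mono; congr tmono; apply: eq_from_tnth => i.
by rewrite !tnth_mktuple; do 2![case: eqP => _ //]; rewrite mulmA.
Qed.

Lemma ract_tcons h (t : tensH n) b : ract (tcons h t) b = tcons (h * b) t.
Proof.
move: t; apply: tensH_ext => [c f g|c f g|t].
- by rewrite tcons_linr ract_linl.
- by rewrite tcons_linr.
move: h; apply: frakH_ext => [c f g|c f g|v].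
- by rewrite tcons_linl ract_linl.
- by rewrite mulr_linl tcons_linl.
move: b; apply: frakH_ext => [c f g|c f g|u].
- by rewrite ract_linr.
- by rewrite mulr_linr tcons_linl.
rewrite -mono_mul !tcons_mono ract_mono; congr tmono.
apply: eq_from_tnth => i; rewrite tnth_mktuple.
by case: (unliftP ord0 i) => [j|] -> //=; rewrite !tnthS.
Qed.

Lemma ract_tens (h : n.+1.-tuple frakH) b :
  ract (tens h) b =
  tens [tuple if i == ord0 then tnth h i * b else tnth h i | i < n.+1].
Proof.
rewrite [LHS]ract_tcons [RHS]/= [thead (mktuple _)]tnth_mktuple.
congr (tcons _ (tens _)).
apply: eq_from_tnth => i; rewrite !tnth_behead tnth_mktuple.
by rewrite -val_eqE /= inordK // ltnS ltn_ord.
Qed.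

End BimoduleTheory.

Lemma lact_tcons n a h (T : tensH n.+1) :
  lact a (tcons h T) = tcons h (lact a T).
Proof.
move: T; apply: tensH_ext => [c f g|c f g|t].
- by rewrite tcons_linr lact_linr.
- by rewrite lact_linr tcons_linr.
move: h; apply: frakH_ext => [c f g|c f g|v].
- by rewrite tcons_linl lact_linr.
- by rewrite tcons_linl.
move: a; apply: frakH_ext => [c f g|c f g|u].
- by rewrite lact_linl.
- by rewrite lact_linl tcons_linr.
rewrite tcons_mono !lact_mono tcons_mono; congr tmono.
apply: eq_from_tnth => i; rewrite tnth_mktuple.
case: (unliftP ord0 i) => [j|] -> //=; rewrite !tnthS tnth_mktuple.
by rewrite -!val_eqE /= /bump leq0n add1n eqSS.
Qed.

Lemma lact_tens n a (h : n.+1.-tuple frakH) :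
  lact a (tens h) =
  tens [tuple if i == ord_max then a * tnth h i else tnth h i | i < n.+1].
Proof.
elim: n h => [|n IH] h.
  rewrite [tens h]/= [RHS]/= [thead (mktuple _)]tnth_mktuple -/(thead h).
  have -> : (ord0 == ord_max :> 'I_1) = true by [].
  move: (thead h).
  apply: frakH_ext => [c f g|c f g|v].
  - by rewrite tcons_linl lact_linr.
  - by rewrite mulr_linr tcons_linl.
  move: a; apply: frakH_ext => [c f g|c f g|u].
  - by rewrite lact_linl.
  - by rewrite mulr_linl tcons_linl.
  rewrite -mono_mul !tcons_mono lact_mono; congr tmono.
  by apply: eq_from_tnth => i; rewrite tnth_mktuple ord1.
rewrite [tens h]/= lact_tcons IH [RHS]/= [thead (mktuple _)]tnth_mktuple.
congr (tcons _ (tens _)).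
apply: eq_from_tnth => i; rewrite tnth_behead !tnth_mktuple tnth_behead.
by rewrite -!val_eqE /= inordK ?eqSS // ltnS ltn_ord.
Qed.

Lemma mulT_tens k (h : k.-tuple frakH) : mulT (tens h) = \prod_(i < k) tnth h i.
Proof.
have mulT_tcons j g (t : tensH j) : mulT (tcons g t) = g * mulT t.
  move: t; apply: tensH_ext => [c t1 t2|c t1 t2|t].
  - by rewrite tcons_linr mulT_lin.
  - by rewrite mulT_lin mulr_linr.
  move: g; apply: frakH_ext => [c f g|c f g|u].
  - by rewrite tcons_linl mulT_lin.
  - by rewrite mulr_linl.
  rewrite tcons_mono !mulT_mono -mono_mul big_ord_recl; congr (mono (mmul _ _)).
  by apply: eq_bigr => i _; rewrite tnthS.
elim: k h => [|k IH] h; first by rewrite [LHS]mulT_mono !big_ord0 mono1.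
rewrite [tens h]/= mulT_tcons IH big_ord_recl; congr (_ * _).
apply: eq_bigr => i _; rewrite tnth_behead; congr tnth; apply: val_inj.
by rewrite /= inordK // ltnS ltn_ord.
Qed.

Section CyclicTheory.
Variable n : nat.
Notation C := (@C n).
Notation xzy := (xzy n).

Lemma C_lin c f g : C (c *: f + g) = c *: C f + C g.
Proof. exact: linext_is_linear. Qed.

Lemma C_mono (w : word) : C (mono w) = Cword n w.
Proof. exact: linextU. Qed.

Lemma C_x : C xH = xzy.
Proof. by rewrite C_mono [letters _]fmU /= lact0 addr0 -fmoneE [LHS]ract1. Qed.

Lemma C_y : C yH = - xzy.
Proof. by rewrite C_mono [letters _]fmU /= lact0 addr0 -fmoneE [LHS]ract1. Qed.

Lemma Cword_cat s t : Cword n (s ++ t) =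
  ract (Cword n s) (mono (FMonom t)) + lact (mono (FMonom s)) (Cword n t).
Proof.
elim: s => [|b s IH].
  by rewrite [Cword n [::]]/= ract0 add0r -fmoneE [RHS]lact1.
rewrite [LHS]/= [Cword n (b :: s)]/= word_cat word_cons !mono_mul.
rewrite ractM lactM IH ractD lactD lact_ract; exact: addrA.
Qed.

Lemma C_mul w w' : C (w * w') = ract (C w) w' + lact w (C w').
Proof.
move: w'; apply: frakH_ext => [c f g|c f g|v].
- by rewrite mulr_linr C_lin.
- rewrite C_lin ract_linr lact_linr scalerDr; exact: addrACA.
move: w; apply: frakH_ext => [c f g|c f g|u].
- by rewrite mulr_linl C_lin.
- rewrite C_lin ract_linl lact_linl scalerDr; exact: addrACA.
by rewrite -mono_mul !C_mono [letters (mmul _ _)]fmM Cword_cat !fmK.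
Qed.

Lemma C_unique (D : {linear frakH -> tensH n.+1}) :
  D xH = xzy -> D yH = - xzy ->
  (forall w w', D (w * w') = ract (D w) w' + lact w (D w')) ->
  D =1 C.
Proof.
move=> Dx Dy DM; have D1 : D 1 = 0.
  apply: (addrI (D 1)); rewrite addr0 -[in RHS](mulr1 1) DM.
  by rewrite ract1 lact1.
apply: frakH_ext => [||[s]]; [exact: linearP | exact: C_lin |].
elim: s => [|b s IH].
  by rewrite C_mono -fmoneE [mono _]mono1 D1 [letters _]fm1.
have Db : D (mono (fmu b)) = C (mono (fmu b)).
  by case: b; [rewrite [LHS]Dy [RHS]C_y | rewrite [LHS]Dx [RHS]C_x].
by rewrite word_cons mono_mul DM C_mul IH Db.
Qed.

End CyclicTheory.

(* Main.v *)
Require Import Defs.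
From HB Require Import structures.
From mathcomp Require Import all_boot all_order all_algebra.
From mathcomp.multinomials Require Import monalg.
From mathcomp Require Import boolp classical_sets reals topology normedtype.
From mathcomp Require Import sequences realfun zify ring lra.

(* [rho n] only involves a cyclic derivation D(w, b) with D(x + y, b) = 0, so
   rho_n(w) = rho_1(w z^(n-1)), and w z^(n-1) expands into words that contain
   both letters as soon as w does.  Moreover rho_1(ab) = rho_1(ba), so one may
   take a word x^(k_1-1) y ... x^(k_m-1) y with some k_i > 1; there the claim is
   the cyclic sum formula of Hoffman and Ohno, of which we prove a version for
   the sums truncated at N.  With
     T_N(k_1,...,k_m) = sum over N > a_1 > ... > a_(m+1) > 0
                        of 1 / (a_1^k_1 ... a_m^k_m (a_1 - a_(m+1))),
   partial fractions and telescoping in a_1 show that the contribution of one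
   rotation of the index is T_N(k_2,...,k_m,k_1) - T_N(k_1,...,k_m) - E_N, where
   E_N comes from a_1 being truncated at N and is O((log N)^m / N) because some
   k_i > 1.  Summing over all rotations, the T_N cancel and only the error terms
   remain. *)

Set Implicit Arguments.
Unset Strict Implicit.
Unset Printing Implicit Defensive.

Import Order.TTheory GRing.Theory Num.Theory.
Import numFieldNormedType.Exports.
Local Open Scope classical_set_scope.
Local Open Scope ring_scope.

(** * The truncated cyclic sum formula *)

(* The contribution of one cyclic rotation to the cyclic sum formula: the first
   sum comes from deleting an x in the first block of the word with index s, the
   last term from deleting the y that ends this block. *)
Definition cyclic_form (V : zmodType) (z : seq nat -> V) (s : seq nat) : V :=
  \sum_(0 <= j < (head 0 s).-1) z (head 0 s - j :: rcons (behead s) j.+1)%N -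
  z ((head 0 (rot 1 s)).+1 :: behead (rot 1 s))%N.

(** Only indices with positive entries are evaluated. This matters when zeta values replace values
    of [Z], which [Z_word] identifies for such indices alone. *)
Lemma eq_cyclic_form (V : zmodType) (z1 z2 : seq nat -> V) s : s != [::] ->
  all (leq 1) s -> (forall t, all (leq 1) t -> z1 t = z2 t) ->
  cyclic_form z1 s = cyclic_form z2 s.
Proof.
case: s => // k s _ /= /andP[k_ge1 s_ge1] z12; rewrite /cyclic_form.
congr (_ - _).
  apply: eq_big_nat => j /andP[_ jk]; apply: z12.
  by rewrite /= all_rcons s_ge1 andbT; rewrite /= in jk; lia.
apply: z12; have : all (leq 1) (rot 1 (k :: s)).
  by rewrite (eq_all_r (mem_rot _ _)) /= k_ge1.
by rewrite rot1_cons; case: (rcons s k) (size_rcons s k) => // l t _ /andP[_].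
Qed.

Lemma raddf_cyclic_form (V W : zmodType) (f : {additive V -> W}) z s :
  f (cyclic_form z s) = cyclic_form (f \o z) s.
Proof. by rewrite /cyclic_form raddfB raddf_sum. Qed.

Section NestedSums.
Context (R : realType).
Implicit Types (f g : nat -> R) (ks s : seq nat) (k a b c m M N : nat).

(* The sum of f(m_r) / (m_1^k_1 ... m_r^k_r) over M > m_1 > ... > m_r > 0,
   and f(M) when r = 0. *)
Fixpoint chain f ks M : R :=
  if ks is k :: ks' then \sum_(1 <= m < M) (m%:R ^+ k)^-1 * chain f ks' m
  else f M.

Lemma zeta_ltE ks M : zeta_lt R ks M = chain (fun=> 1) ks M.
Proof. by elim: ks M => //= k ks IH M; apply: eq_bigr => m _; rewrite IH. Qed.

Lemma eq_chain f g ks M : (0 < M)%N ->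
  (forall c, (0 < c <= M)%N -> f c = g c) -> chain f ks M = chain g ks M.
Proof.
elim: ks M => /= [|k ks IH] M M_gt0 fg; first by rewrite fg // M_gt0 leqnn.
apply: eq_big_nat => m /andP[m_gt0 ltmM]; rewrite (IH m) // => c /andP[c0 cm].
by rewrite fg // c0 (leq_trans cm) // ltnW.
Qed.

Lemma chain_sum (I : Type) (r : seq I) (F : I -> nat -> R) ks M :
  chain (fun c => \sum_(i <- r) F i c) ks M = \sum_(i <- r) chain (F i) ks M.
Proof.
elim: ks M => //= k ks IH M; rewrite exchange_big /=.
by apply: eq_bigr => m _; rewrite IH mulr_sumr.
Qed.

Lemma chainD f g ks M :
  chain (fun c => f c + g c) ks M = chain f ks M + chain g ks M.
Proof.
elim: ks M => //= k ks IH M; rewrite -big_split.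
by apply: eq_bigr => m _; rewrite IH mulrDr.
Qed.

Lemma chainZ (x : R) f ks M : chain (fun c => x * f c) ks M = x * chain f ks M.
Proof.
elim: ks M => //= k ks IH M; rewrite mulr_sumr.
by apply: eq_bigr => m _; rewrite IH mulrCA.
Qed.

Lemma chainB f g ks M :
  chain (fun c => f c - g c) ks M = chain f ks M - chain g ks M.
Proof.
elim: ks M => //= k ks IH M; rewrite -sumrB.
by apply: eq_bigr => m _; rewrite IH mulrBr.
Qed.

Lemma chain_rcons f ks k M : chain f (rcons ks k) M =
  chain (fun b => \sum_(1 <= c < b) (c%:R ^+ k)^-1 * f c) ks M.
Proof. by elim: ks M => //= l ks IH M; apply: eq_bigr => m _; rewrite IH. Qed.

Lemma chain_ge0 f ks M : (0 < M)%N ->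
  (forall c, (0 < c <= M)%N -> 0 <= f c) -> 0 <= chain f ks M.
Proof.
elim: ks M => /= [|k ks IH] M M_gt0 f0; first by rewrite f0 // M_gt0 leqnn.
rewrite big_nat; apply: sumr_ge0 => m /andP[m_gt0 ltmM].
rewrite mulr_ge0 ?invr_ge0 ?exprn_ge0 ?ler0n // IH // => c /andP[c0 cm].
by rewrite f0 // c0 (leq_trans cm) // ltnW.
Qed.

(** * Partial fractions and telescoping *)

Definition hsum a b : R := \sum_(0 <= c < b) (a - c)%:R^-1.

(** For c <= a, [hsum a c] is the harmonic block 1/a + ... + 1/(a-c+1). Replacing a by a+1 shifts
    the block by one place, so only the two ends survive in the difference. *)
Lemma hsum_step a c :
  (a.+1 - c)%:R^-1 - a.+1%:R^-1 = hsum a c - hsum a.+1 c :> R.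
Proof.
rewrite /hsum -sumrB.
have := @telescope_sumr R 0 c (fun i => (a.+1 - i)%:R^-1) (leq0n c).
by rewrite /= subn0 => <-; apply: eq_bigr => i _; rewrite subSS.
Qed.

Lemma hsum_telescope m N c : (m < N)%N ->
  \sum_(m.+1 <= a < N) ((a - c)%:R^-1 - a%:R^-1) = hsum m c - hsum N.-1 c.
Proof.
elim: N => // N IH; rewrite ltnS leq_eqVlt => /predU1P[->|ltmN].
  by rewrite big_geq // subrr.
rewrite big_nat_recr //= IH //; case: N {IH} ltmN => // N _.
by rewrite hsum_step /= addrA subrK.
Qed.

(** Iterating the case k = 1 ([base]) trades the factors 1/a for factors 1/c one at a time. Each
    trade after the first leaves one mixed term behind. *)
Lemma partial_fractions k a c : (0 < k)%N -> (0 < c < a)%N ->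
  (a%:R ^+ k)^-1 * (a - c)%:R^-1 =
  (c%:R ^+ k)^-1 * ((a - c)%:R^-1 - a%:R^-1) -
  \sum_(0 <= j < k.-1) (a%:R ^+ (k - j))^-1 * (c%:R ^+ j.+1)^-1 :> R.
Proof.
move=> + /andP[c0 ca]; rewrite natrB ?(ltnW ca) //.
have c_neq0 : c%:R != 0 :> R by rewrite pnatr_eq0 -lt0n.
have a_neq0 : a%:R != 0 :> R by rewrite pnatr_eq0 -lt0n (ltn_trans c0).
have d_neq0 : a%:R - c%:R != 0 :> R by rewrite subr_eq0 eqr_nat gt_eqF.
have base : a%:R^-1 * (a%:R - c%:R)^-1 =
    c%:R^-1 * ((a%:R - c%:R)^-1 - a%:R^-1) :> R.
  by field; rewrite c_neq0 a_neq0 d_neq0.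
elim: k => // -[|k] IH _; first by rewrite big_geq // subr0 !expr1.
rewrite exprS invfM -mulrA IH // [in RHS]big_nat_recr //=.
rewrite (_ : \sum_(0 <= i < k) (a%:R ^+ (k.+2 - i))^-1 * (c%:R ^+ i.+1)^-1 =
  a%:R^-1 * \sum_(0 <= j < k) (a%:R ^+ (k.+1 - j))^-1 * (c%:R ^+ j.+1)^-1);
  last first.
  rewrite mulr_sumr; apply: eq_big_nat => j /andP[_ jk].
  by rewrite subSn 1?ltnW ?ltnS 1?ltnW // exprS invfM mulrA.
rewrite (exprS c%:R k.+1) invfM.
move: (\sum_(0 <= j < k) _) (c%:R ^+ k.+1)^-1 => S X.
(* The new mixed term, j = k, is 1/(a^2 c^(k+1)). *)
by rewrite (_ : k.+2 - k = 2)%N; [field; rewrite a_neq0 c_neq0 d_neq0 | lia].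
Qed.

Lemma exchange_triangle (G : nat -> nat -> R) N :
  \sum_(1 <= a < N) \sum_(1 <= m < a) G a m =
  \sum_(1 <= m < N) \sum_(m.+1 <= a < N) G a m.
Proof.
elim: N => [|[|N] IH]; [by rewrite !big_geq | by rewrite !big_geq |].
rewrite [LHS]big_nat_recr //= IH [RHS]big_nat_recr //=.
rewrite [\sum_(N.+2 <= _ < _) _]big_geq // addr0 -big_split.
by apply: eq_big_nat => m /andP[_ mN]; rewrite [RHS]big_nat_recr.
Qed.

(* The sum T_N of the header, with its summands as functions of a_1 = a. *)
Definition cyclic_tail N s : R :=
  \sum_(1 <= a < N) (a%:R ^+ head 0 s)^-1 *
    chain (fun b => \sum_(1 <= c < b) (a - c)%:R^-1) (behead s) a.

(* The error term E_N of the header. *)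
Definition cyclic_defect N s : R := chain (hsum N.-1) s N.

Lemma cyclic_form_trunc N s : s != [::] -> all (leq 1) s ->
  cyclic_form ((zeta_lt R)^~ N) s =
  cyclic_tail N (rot 1 s) - cyclic_tail N s - cyclic_defect N (rot 1 s).
Proof.
case: s => // k ks _ /= /andP[k_gt0 _]; rewrite rot1_cons /cyclic_form /=.
rewrite rot1_cons.
(* Partial fractions between the outermost a and the innermost c move the exponent k from a to c, so
   the index becomes [rcons ks k]. The mixed terms give the first sum of [cyclic_form]. *)
have -> : cyclic_tail N (k :: ks) =
    \sum_(1 <= a < N) chain (fun c => (a - c)%:R^-1 - a%:R^-1) (rcons ks k) a -
    \sum_(0 <= j < k.-1) zeta_lt R (k - j :: rcons ks j.+1)%N N.
  rewrite exchange_big /= -sumrB; apply: eq_big_nat => a /andP[a_gt0 _].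
  have -> : \sum_(0 <= j < k.-1)
      (a%:R ^+ (k - j))^-1 * zeta_lt R (rcons ks j.+1) a =
    \sum_(0 <= j < k.-1) chain (fun b => \sum_(1 <= c < b)
      (a%:R ^+ (k - j))^-1 * (c%:R ^+ j.+1)^-1) ks a.
    apply: eq_bigr => j _; rewrite zeta_ltE chain_rcons -chainZ.
    apply: eq_chain => // b _; rewrite mulr_sumr.
    by apply: eq_bigr => c _; rewrite mulr1.
  rewrite chain_rcons -chainZ -chain_sum -chainB.
  apply: eq_chain => // b /andP[_ leba].
  rewrite exchange_big /= mulr_sumr -sumrB.
  apply: eq_big_nat => c /andP[c_gt0 cb].
  by rewrite partial_fractions // c_gt0 (leq_trans cb).
(* Now a occurs only in the weight. With the next variable m fixed, the sum over m < a < N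
   telescopes to [hsum m c - hsum N.-1 c]. *)
have -> : \sum_(1 <= a < N) chain (fun c => (a - c)%:R^-1 - a%:R^-1)
      (rcons ks k) a =
    zeta_lt R ((head 0 (rcons ks k)).+1 :: behead (rcons ks k)) N +
    cyclic_tail N (rcons ks k) - cyclic_defect N (rcons ks k).
  rewrite /cyclic_tail /cyclic_defect.
  case: (rcons ks k) (size_rcons ks k) => //= l ls _.
  rewrite -big_split -sumrB /=.
  rewrite exchange_triangle; apply: eq_big_nat => m /andP[m_gt0 ltmN].
  rewrite zeta_ltE exprSr invfM -mulrA -mulrDr -mulrBr -mulr_sumr.
  congr (_ * _); rewrite -chain_sum -chainZ -chainD -chainB.
  apply: eq_chain => // c /andP[c_gt0 lecm].
  (* The leading term 1/m of [hsum m c] raises the first exponent by one; its other terms make up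
     the rotated tail. *)
  by rewrite hsum_telescope // mulr1 /hsum [in LHS]big_ltn // subn0.
move: (cyclic_tail _ _) (cyclic_defect _ _) => T D /=; ring.
Qed.

Lemma cyclic_form_trunc_rot N s : all (leq 1) s ->
  \sum_(0 <= i < size s) cyclic_form ((zeta_lt R)^~ N) (rot i s) =
  - \sum_(0 <= i < size s) cyclic_defect N (rot i.+1 s).
Proof.
move=> s_ge1; rewrite (eq_big_nat _ _ (F2 := fun i =>
    (cyclic_tail N (rot i.+1 s) - cyclic_tail N (rot i s)) -
    cyclic_defect N (rot i.+1 s))).
  rewrite sumrB (telescope_sumr (fun i => cyclic_tail N (rot i s))) //.
  by rewrite rot_size rot0 subrr sub0r.
move=> i /andP[_ lt_is]; rewrite cyclic_form_trunc -?rotS //; last first.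
  by rewrite (eq_all_r (mem_rot i s)).
by rewrite -size_eq0 size_rot -lt0n (leq_ltn_trans _ lt_is).
Qed.

(** * Growth estimates: convergence of zeta values and decay of the error term *)

Definition harm N : R := \sum_(1 <= m < N) m%:R^-1.

Lemma harm_ge0 N : 0 <= harm N.
Proof. by apply: sumr_ge0 => m _; rewrite invr_ge0 ler0n. Qed.

Lemma harmS N : (0 < N)%N -> harm N.+1 = harm N + N%:R^-1.
Proof. by move=> N_gt0; rewrite /harm big_nat_recr. Qed.

Lemma le_harm : {homo harm : M N / (M <= N)%N >-> M <= N}.
Proof.
apply: homo_leq => [//|? ? ?|[|N]]; first exact: le_trans.
  by rewrite /harm !big_geq.
by rewrite [leRHS]harmS // lerDl invr_ge0 ler0n.
Qed.

Lemma inv_expn_le k l m : (0 < m)%N -> (l <= k)%N ->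
  (m%:R ^+ k)^-1 <= (m%:R ^+ l)^-1 :> R.
Proof.
move=> m_gt0 lk; rewrite lef_pV2 ?posrE ?exprn_gt0 ?ltr0n //.
by rewrite ler_weXn2l ?ler1n.
Qed.

(** Lower every exponent to 1 and let the summation variables run independently below M. *)
Lemma chain_le_harm f (B : R) ks M : (0 < M)%N -> all (leq 1) ks ->
  (forall c, (0 < c <= M)%N -> 0 <= f c <= B) ->
  chain f ks M <= B * harm M ^+ size ks.
Proof.
move=> M_gt0 + fB; have fB' m : (0 < m)%N -> (m <= M)%N -> 0 <= f m <= B.
  by move=> m_gt0 mM; apply: fB; rewrite m_gt0.
have B_ge0 : 0 <= B by have /andP[/le_trans] := fB' M M_gt0 (leqnn M); apply.
suff H m : (0 < m)%N -> (m <= M)%N -> all (leq 1) ks ->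
    chain f ks m <= B * harm m ^+ size ks by exact: H.
elim: ks m => /= [|k ks IH] m m_gt0 mM.
  by rewrite mulr1; have /andP[] := fB' m m_gt0 mM.
move=> /andP[k_gt0 ks_gt0].
rewrite exprS mulrCA /harm mulr_suml; apply: ler_sum_nat => l /andP[l_gt0 lm].
have lM := leq_trans (ltnW lm) mM.
apply: ler_pM.
- by rewrite invr_ge0 exprn_ge0.
- apply: chain_ge0 => // c /andP[c0 cl].
  by have /andP[] := fB' c c0 (leq_trans cl lM).
- by rewrite -[X in _ <= X^-1]expr1 inv_expn_le.
apply: le_trans (IH l l_gt0 lM ks_gt0) _.
by rewrite ler_wpM2l // lerXn2r ?nnegrE ?harm_ge0 // le_harm // ltnW.
Qed.

(** The first variable m with exponent at least 2 keeps a factor 1/m^2. By monotonicity the weight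
    is at most f(m) there, and every other variable costs one factor [harm M]. *)
Lemma chain_le_defect f ks M : all (leq 1) ks -> has (leq 2) ks ->
  (forall c, 0 <= f c) -> {homo f : a b / (a <= b)%N >-> a <= b} ->
  chain f ks M <=
  harm M ^+ (size ks).-1 * \sum_(1 <= m < M) (m%:R ^+ 2)^-1 * f m.
Proof.
move=> + + f0 f_mono; elim: ks M => //= k ks IH M /andP[k_gt0 ks_gt0].
case: (leqP 2 k) => [k_ge2 _|_ /= ks2].
  rewrite mulr_sumr; apply: ler_sum_nat => m /andP[m_gt0 ltmM].
  rewrite mulrCA; apply: ler_pM.
  - by rewrite invr_ge0 exprn_ge0.
  - by apply: chain_ge0.
  - exact: inv_expn_le.
  rewrite mulrC; apply: le_trans (@chain_le_harm f (f m) ks m m_gt0 ks_gt0 _) _.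
    by move=> c /andP[_ cm]; rewrite f0 f_mono.
  by rewrite ler_wpM2l // lerXn2r ?nnegrE ?harm_ge0 // le_harm // ltnW.
have -> : size ks = (size ks).-1.+1 by case: (ks) ks2.
rewrite exprS -mulrA {1}/harm mulr_suml; apply: ler_sum_nat => m /andP[m0 mM].
apply: ler_pM.
- by rewrite invr_ge0 exprn_ge0.
- by apply: chain_ge0.
- by rewrite -[X in _ <= X^-1]expr1 inv_expn_le.
apply: le_trans (IH m ks_gt0 ks2) _; apply: ler_pM.
- by rewrite exprn_ge0 // harm_ge0.
- by apply: sumr_ge0 => l _; rewrite mulr_ge0 // invr_ge0 exprn_ge0.
- by rewrite lerXn2r ?nnegrE ?harm_ge0 // le_harm // ltnW.
rewrite [leRHS](big_cat_nat m0 (ltnW mM)) //= lerDl.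
by apply: sumr_ge0 => l _; rewrite mulr_ge0 // invr_ge0 exprn_ge0.
Qed.

(** A discrete mean value estimate: factor the difference of powers and bound each of the p+1
    products by Y^p. *)
Lemma expr_increment p (X Y : R) : 0 <= X <= Y ->
  Y ^+ p.+1 <= X ^+ p.+1 + p.+1%:R * (Y - X) * Y ^+ p.
Proof.
move=> /andP[X0 XY]; rewrite -lerBlDl subrXX -mulrA mulrCA.
rewrite ler_wpM2l ?subr_ge0 //.
rewrite -[p.+1 in leRHS]card_ord mulr_natl -sumr_const; apply: ler_sum => i _.
have ip : (i <= p)%N by rewrite -ltnS.
rewrite -[X in _ <= _ ^+ X](subnK ip) exprD ler_wpM2l //.
  by rewrite exprn_ge0 // (le_trans X0).
by rewrite lerXn2r ?nnegrE // (le_trans X0).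
Qed.

Lemma sqr_sqrt_nat m : Num.sqrt m%:R ^+ 2 = m%:R :> R.
Proof. by rewrite sqr_sqrtr. Qed.

Lemma sqrt_nat_ge1 m : (0 < m)%N -> 1 <= Num.sqrt m%:R :> R.
Proof. by move=> m_gt0; rewrite -[leLHS]sqrtr1 ler_sqrt ?ler1n ?ltr0n. Qed.

(** Powers of a logarithm are O(sqrt N). By induction on p, the increment of the next power is at
    most (p+1) B sqrt(N+2)/(N+1), which is compared with an increment of the square root. *)
Lemma harm_expn_le_sqrt p : exists2 B : R, 0 <= B &
  forall N, (0 < N)%N -> harm N ^+ p <= B * Num.sqrt N%:R.
Proof.
elim: p => [|p [B B_ge0 IH]].
  by exists 1 => // N N_gt0; rewrite expr0 mul1r sqrt_nat_ge1.
exists (4 * p.+1%:R * B); first by rewrite !mulr_ge0.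
elim=> // -[|N] IHN _.
  by rewrite /harm big_geq // expr0n /= !mulr_ge0 // sqrtr_ge0.
have {IHN} := IHN isT; have {IH} := IH N.+2 isT; rewrite harmS //.
have := @expr_increment p (harm N.+1) (harm N.+1 + N.+1%:R^-1).
rewrite harm_ge0 lerDl invr_ge0 ler0n addrAC subrr add0r => /(_ isT).
have := sqrt_nat_ge1 (ltn0Sn N); have := sqr_sqrt_nat N.+1.
have := sqrt_nat_ge1 (ltn0Sn N.+1); have := sqr_sqrt_nat N.+2.
move: (Num.sqrt N.+1%:R : R) (Num.sqrt N.+2%:R : R) => s t.
rewrite -[N.+2%:R]natr1 => t2 t1 s2 s1; rewrite -s2 in t2 *.
move: (_ ^+ p.+1) (_ ^+ p.+1) (_ ^+ p) => X Y Yp YX YpB XB.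
(* Here s^2 = N+1 and t^2 = s^2 + 1, so t - s = 1/(t+s) and the claim amounts to [h]. This is the
   origin of the constant 4. *)
have key : (s ^+ 2)^-1 * t <= 4 * (t - s).
  rewrite mulrC ler_pdivrMr; last by nra.
  have h : t * (t + s) <= 4 * s ^+ 2 by nra.
  have ts : 0 <= t - s by nra.
  rewrite [leLHS](_ : t = t * (t + s) * (t - s)); last by ring: t2.
  by rewrite [leRHS]mulrAC ler_wpM2r.
apply: le_trans YX _.
have -> : 4 * p.+1%:R * B * t =
    4 * p.+1%:R * B * s + p.+1%:R * (B * (4 * (t - s))) by ring.
rewrite lerD // -mulrA ler_wpM2l //.
apply: le_trans (ler_wpM2l B_ge0 key); rewrite mulrCA ler_wpM2l //.
by rewrite invr_ge0 sqr_ge0.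
Qed.

Lemma sum_inv_sqrt_bound N :
  \sum_(1 <= m < N) (m%:R ^+ 2)^-1 * Num.sqrt m%:R <= 6 :> R.
Proof.
(* Telescoping: m^(-3/2) <= 6 (m^(-1/2) - (m+1)^(-1/2)). *)
suff: (0 < N)%N -> \sum_(1 <= m < N) (m%:R ^+ 2)^-1 * Num.sqrt m%:R <=
    6 - 6 * (Num.sqrt N%:R)^-1 :> R.
  case: (posnP N) => [->|_ /(_ isT)/le_trans-> //]; first by rewrite big_geq.
  by rewrite gerBl mulr_ge0 // invr_ge0 sqrtr_ge0.
elim: N => // -[|N] IH _; first by rewrite big_geq // sqrtr1 invr1 mulr1 subrr.
rewrite big_nat_recr //=; apply: le_trans (lerD (IH isT) (lexx _)) _.
have := sqrt_nat_ge1 (ltn0Sn N); have := sqr_sqrt_nat N.+1.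
have := sqrt_nat_ge1 (ltn0Sn N.+1); have := sqr_sqrt_nat N.+2.
move: (Num.sqrt N.+1%:R : R) (Num.sqrt N.+2%:R : R) => s t.
rewrite -[N.+2%:R]natr1 => t2 t1 s2 s1; rewrite -s2 in t2 *.
have h : t * (t + s) <= 4 * s ^+ 2 by nra.
have -> : (s ^+ 2 ^+ 2)^-1 * s = (s ^+ 3)^-1 by field; rewrite gt_eqF //; lra.
have -> : 6 - 6 / t = 6 - 6 / s + 6 * (s^-1 - t^-1) by ring.
rewrite lerD2l.
(* Since t^2 - s^2 = 1; by [h] this difference is at least 1/(4 s^3), so six times it dominates the
   new term 1/s^3. *)
have -> : s^-1 - t^-1 = (s * (t * (t + s)))^-1.
  have -> : s^-1 - t^-1 = (t - s) * (t + s) / (s * (t * (t + s))).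
    by field; rewrite !gt_eqF //; lra.
  by rewrite (_ : (t - s) * (t + s) = 1) ?mul1r //; ring: t2.
have s_gt0 : 0 < s by lra.
have t_gt0 : 0 < t by lra.
rewrite ler_pdivlMr ?mulr_gt0 ?addr_gt0 // ler_pdivrMl ?exprn_gt0 //.
have -> : s ^+ 3 * 6 = s * (6 * s ^+ 2) by ring.
by rewrite ler_wpM2l ?ltW //; nra.
Qed.

(** The truncated sums increase with N. The inner sum at m is O(sqrt m) and the first exponent is at
    least 2, so they are bounded by a multiple of the sum of m^(-3/2). *)
Lemma cvg_zeta_lt ks : all (leq 1) ks -> (1 < head 0 ks)%N ->
  zeta_lt R ks @ \oo --> zeta R ks.
Proof.
case: ks => // k ks /= /andP[_ ks_gt0] k_gt1.
have zeta_ge0 l m : (0 < m)%N -> 0 <= (m%:R ^+ l)^-1 * zeta_lt R ks m.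
  move=> m_gt0; rewrite mulr_ge0 ?invr_ge0 ?exprn_ge0 // zeta_ltE.
  exact: chain_ge0.
apply: nondecreasing_is_cvgn.
  apply: homo_leq => [//|? ? ?|[|N] /=]; first exact: le_trans.
    by rewrite !big_geq.
  by rewrite [leRHS]big_nat_recr //= lerDl zeta_ge0.
have [B B_ge0 harmB] := harm_expn_le_sqrt (size ks).
exists (B * 6) => _ [N _ <-] /=.
apply: le_trans (ler_wpM2l B_ge0 (sum_inv_sqrt_bound N)); rewrite mulr_sumr.
apply: ler_sum_nat => m /andP[m_gt0 _]; rewrite mulrCA ler_pM //.
- by rewrite invr_ge0 exprn_ge0.
- by rewrite zeta_ltE chain_ge0.
- exact: inv_expn_le.
- rewrite zeta_ltE; apply: le_trans (harmB _ m_gt0); rewrite -[leRHS]mul1r.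
  by apply: chain_le_harm => // c _; rewrite ler01 lexx.
Qed.

Lemma hsum_ge0 a b : 0 <= hsum a b.
Proof. by apply: sumr_ge0 => c _; rewrite invr_ge0. Qed.

Lemma le_hsum a : {homo hsum a : b c / (b <= c)%N >-> b <= c}.
Proof.
move=> b c bc; rewrite [leRHS](big_cat_nat (leq0n b) bc) //= lerDl.
by apply: sumr_ge0 => i _; rewrite invr_ge0.
Qed.

(** Each of the m terms of [hsum N m] is at most 1/(N+1-m), and 1/(m(N+1-m)) splits into partial
    fractions. *)
Lemma hsum_bound N m : (0 < m <= N)%N ->
  (m%:R ^+ 2)^-1 * hsum N m <= N.+1%:R^-1 * (m%:R^-1 + (N.+1 - m)%:R^-1).
Proof.
move=> /andP[m_gt0 mN].
have -> : N.+1%:R^-1 * (m%:R^-1 + (N.+1 - m)%:R^-1) =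
    (m%:R ^+ 2)^-1 * (m%:R * (N.+1 - m)%:R^-1) :> R.
  rewrite natrB ?(leqW mN) //; field.
  by rewrite nat1r subr_eq0 eqr_nat !pnatr_eq0 -lt0n m_gt0 gt_eqF.
rewrite ler_wpM2l ?invr_ge0 ?exprn_ge0 // mulr_natl -[X in _ *+ X]subn0.
rewrite -sumr_const_nat; apply: ler_sum_nat => c /andP[_ cm].
by rewrite lef_pV2 ?posrE ?ltr0n ?ler_nat; lia.
Qed.

Lemma sum_hsum_bound N :
  \sum_(1 <= m < N.+1) (m%:R ^+ 2)^-1 * hsum N m <=
  N.+1%:R^-1 * (2 * harm N.+1).
Proof.
rewrite mulr_natl mulr2n -{2}/(harm _).
(* Reflection of m to N+1-m. *)
have {2}-> : harm N.+1 = \sum_(1 <= m < N.+1) (N.+1 - m)%:R^-1.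
  by rewrite /harm big_nat_rev /=; apply: eq_bigr => m _; rewrite add1n subSS.
rewrite -big_split mulr_sumr; apply: ler_sum_nat => m mN; exact: hsum_bound.
Qed.

Lemma cvg_cyclic_defect ks : all (leq 1) ks -> has (leq 2) ks ->
  cyclic_defect ^~ ks @ \oo --> (0 : R).
Proof.
move=> ks_ge1 ks_ge2; have [B B_ge0 harmB] := harm_expn_le_sqrt (size ks).
(* At truncation N+1 the weight is [hsum N], and the error is at most 2 harm(N+1)^r / (N+1), with r
   the length of [ks]; this is at most 2B / sqrt(N+1). *)
rewrite -(cvg_shiftS (cyclic_defect ^~ ks)) /=.
apply: (@squeeze_cvgr _ _ _ _ (fun=> 0)
  (fun N => 2 * B * Num.sqrt (harmonic N))).
- near=> N; rewrite chain_ge0 /=; [|by []|by move=> ? _; apply: hsum_ge0].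
  apply: le_trans (chain_le_defect _ ks_ge1 ks_ge2 (hsum_ge0 _) (@le_hsum _)) _.
  have := ler_wpM2l (exprn_ge0 (size ks).-1 (harm_ge0 N.+1)) (sum_hsum_bound N).
  move=> /le_trans; apply.
  have -> : harm N.+1 ^+ (size ks).-1 * (N.+1%:R^-1 * (2 * harm N.+1)) =
      2 * N.+1%:R^-1 * harm N.+1 ^+ size ks.
    have {2}-> : size ks = (size ks).-1.+1 by case: (ks) ks_ge2.
    by rewrite exprSr; ring.
  have u_gt0 := lt_le_trans ltr01 (sqrt_nat_ge1 (ltn0Sn N)).
  have -> : 2 * B * Num.sqrt (harmonic N) =
      2 * N.+1%:R^-1 * (B * Num.sqrt N.+1%:R) :> R.
    rewrite /harmonic sqrtrV //; have := sqr_sqrt_nat N.+1.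
    move: (Num.sqrt _) u_gt0 => u u_gt0 <-; field; exact: lt0r_neq0.
  by rewrite ler_wpM2l ?harmB // mulr_ge0 ?invr_ge0.
- exact: cvg_cst.
- rewrite -(mulr0 (2 * B)); apply: cvgMr.
  rewrite -sqrtr0; apply: continuous_cvg; first exact: sqrt_continuous.
  exact: cvg_harmonic.
Unshelve. all: by end_near.
Qed.

End NestedSums.

(** * Passage to the limit *)

Lemma cvg_sum_nat (R : realType) m n (u : nat -> nat -> R) (l : nat -> R) :
  (forall i, (m <= i < n)%N -> u i @ \oo --> l i) ->
  (fun N => \sum_(m <= i < n) u i N) @ \oo --> \sum_(m <= i < n) l i.
Proof.
move=> ul; rewrite big_nat; under eq_fun do rewrite big_nat.
by apply: cvg_big => //; exact: add_continuous.
Qed.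

(** Every index that occurs is admissible: j < k-1 gives k-j >= 2, and in the last term the first
    entry has been raised by one. *)
Lemma cvg_cyclic_form (R : realType) s : s != [::] -> all (leq 1) s ->
  (fun N => cyclic_form ((zeta_lt R)^~ N) s) @ \oo --> cyclic_form (zeta R) s.
Proof.
case: s => // k s _ s_ge1; apply: cvgB.
  apply: cvg_sum_nat => j /andP[_ jk]; apply: cvg_zeta_lt;
    rewrite /= in s_ge1 jk *.
    by case/andP: s_ge1 => _ s_ge1; rewrite all_rcons s_ge1 andbT /=; lia.
  by lia.
have : all (leq 1) (rot 1 (k :: s)) by rewrite (eq_all_r (mem_rot _ _)).
rewrite rot1_cons.
case: (rcons s k) (size_rcons s k) => // l t _ /andP[l_ge1 t_ge1].
by apply: cvg_zeta_lt => //; rewrite ltnS.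
Qed.

Lemma cyclic_sum_formula (R : realType) s : all (leq 1) s -> has (leq 2) s ->
  \sum_(0 <= i < size s) cyclic_form (zeta R) (rot i s) = 0.
Proof.
move=> s_ge1 s_ge2; set S := \sum_(_ <= _ < _) _.
have lhs : (fun N => \sum_(0 <= i < size s)
    cyclic_form ((zeta_lt R)^~ N) (rot i s)) @ \oo --> S.
  apply: cvg_sum_nat => i /andP[_ lt_is]; apply: cvg_cyclic_form.
    by rewrite -size_eq0 size_rot -lt0n (leq_ltn_trans _ lt_is).
  by rewrite (eq_all_r (mem_rot _ _)).
have rhs : (fun N => \sum_(0 <= i < size s)
    cyclic_form ((zeta_lt R)^~ N) (rot i s)) @ \oo --> (0 : R).
  under eq_fun do rewrite cyclic_form_trunc_rot //.
  have /cvgN : (fun N => \sum_(0 <= i < size s) cyclic_defect R N (rot i.+1 s))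
      @ \oo --> \sum_(0 <= i < size s) (0 : R).
    apply: cvg_sum_nat => i _; apply: cvg_cyclic_defect.
      by rewrite (eq_all_r (mem_rot _ _)).
    by rewrite (eq_has_r (mem_rot _ _)).
  by rewrite big1_eq oppr0.
exact: (cvg_unique _ lhs rhs).
Qed.

(** * Cyclic derivations *)

(* The model is D(u, b) = M_1(C_1(u) <> b): the Leibniz rule of C_1 takes this
   form because M_1(a <> T) = M_1(T <> a). *)
Record cyclic_derivation (A : pzRingType) (x y : A) (D : A -> A -> A) : Prop :=
  CyclicDerivation {
    cycDD : forall u v b, D (u + v) b = D u b + D v b;
    cycDM : forall u v b, D (u * v) b = D u (v * b) + D v (b * u);
    cycD_x : forall b, D x b = x * b * y;
    cycD_y : forall b, D y b = - (x * b * y) }.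

Section CyclicDerivationTheory.
Context (A : pzRingType) (x y : A) (D : A -> A -> A).
Context (derD : cyclic_derivation x y D).
Implicit Types (b u v : A) (k : nat).

Lemma cycD1 b : D 1 b = 0.
Proof.
apply: (addrI (D 1 b)); rewrite addr0 -[in RHS](mulr1 1) (cycDM derD).
by rewrite mul1r mulr1.
Qed.

Lemma cycD_zX k b : D ((x + y) ^+ k) b = 0.
Proof.
elim: k b => [|k IH] b; first exact: cycD1.
rewrite exprS (cycDM derD) IH addr0 (cycDD derD) (cycD_x derD) (cycD_y derD).
by rewrite subrr.
Qed.

Lemma cycD_MzX u k : D (u * (x + y) ^+ k) 1 = D u ((x + y) ^+ k).
Proof. by rewrite (cycDM derD) cycD_zX addr0 mulr1. Qed.

(** At b = 1 exchanging u and v merely swaps the two Leibniz terms, so a word may be rotated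
    freely. *)
Lemma cycD_comm u v : D (u * v) 1 = D (v * u) 1.
Proof. by rewrite !(cycDM derD) !mulr1 !mul1r addrC. Qed.

Lemma cycD_xX k b :
  D (x ^+ k) b = \sum_(0 <= j < k) x ^+ (k - j) * b * x ^+ j * y.
Proof.
elim: k b => [|k IH] b; first by rewrite big_geq // cycD1.
rewrite exprSr (cycDM derD) IH big_nat_recr //= (cycD_x derD) subSnn expr1.
rewrite !mulrA.
congr (_ + _); apply: eq_big_nat => j /andP[_ /ltnW jk].
by rewrite subSn // exprSr !mulrA.
Qed.

Lemma cycD_xXy k b : D (x ^+ k * y) b =
  \sum_(0 <= j < k) x ^+ (k - j) * (y * b) * x ^+ j * y - x * (b * x ^+ k) * y.
Proof. by rewrite (cycDM derD) cycD_xX (cycD_y derD). Qed.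

(** Iterated Leibniz rule: each factor is differentiated in turn, with the others following in
    cyclic order. The list t collects the factors already passed; the default 0 is never reached, as
    i < [size s]. *)
Lemma cycD_prod (I : Type) (f : I -> A) (s t : seq I) :
  D (\prod_(i <- s) f i) (\prod_(i <- t) f i) =
  \sum_(0 <= i < size s)
    (if rot i (s ++ t) is k :: r then D (f k) (\prod_(j <- r) f j) else 0).
Proof.
elim: s t => [|k s IH] t; first by rewrite big_nil big_geq // cycD1.
rewrite big_cons (cycDM derD) -big_cat big_nat_recl // rot0; congr (_ + _).
have -> : (\prod_(i <- t) f i) * f k = \prod_(i <- rcons t k) f i.
  by rewrite -cats1 big_cat big_seq1.
rewrite IH; apply: eq_big_nat => i /andP[_ lt_is].
rewrite -rcons_cat -rot1_cons rot_rot -rotS /= ?size_cat ?addSn //.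
by rewrite ltnS ltnW // ltn_addr.
Qed.

Definition index_word (ks : seq nat) : A := \prod_(k <- ks) (x ^+ k.-1 * y).

(** Term by term: x^(k-1-j) y b x^j y has index (k-j, ks, j+1), and in x b x^(k-1) y the leading x
    lengthens the first block of [rcons ks k]. *)
Lemma cycD_index_word1 k ks : (0 < k)%N -> all (leq 1) ks ->
  D (x ^+ k.-1 * y) (index_word ks) = cyclic_form index_word (k :: ks).
Proof.
move=> k_gt0 ks_ge1; rewrite cycD_xXy /cyclic_form rot1_cons /=; congr (_ - _).
  apply: eq_big_nat => j /andP[_ jk]; rewrite /index_word big_cons -cats1.
  by rewrite big_cat big_seq1 (_ : (k - j).-1 = k.-1 - j)%N ?mulrA //; lia.
have : \prod_(i <- rcons ks k) (x ^+ i.-1 * y) = index_word ks * x ^+ k.-1 * y.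
  by rewrite -cats1 big_cat big_seq1 /= mulrA.
have : all (leq 1) (rcons ks k) by rewrite all_rcons k_gt0.
case: (rcons ks k) (size_rcons ks k) => //= l ls _ /andP[l_gt0 _].
rewrite big_cons /index_word big_cons -[x * _ * y]mulrA => <- /=.
by rewrite -[in RHS](prednK l_gt0) exprS !mulrA.
Qed.

Lemma cycD_index_word s : all (leq 1) s ->
  D (index_word s) 1 = \sum_(0 <= i < size s) cyclic_form index_word (rot i s).
Proof.
move=> s_ge1; rewrite -[1](big_nil 1 *%R xpredT (fun k => x ^+ k.-1 * y)).
rewrite cycD_prod cats0; apply: eq_big_nat => i /andP[_ lt_is].
have : all (leq 1) (rot i s) by rewrite (eq_all_r (mem_rot _ _)).
case: (rot i s) (size_rot i s) => [s0|k ks _ /andP[k_gt0 ks_ge1]].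
  by rewrite -s0 in lt_is.
exact: cycD_index_word1.
Qed.

End CyclicDerivationTheory.

(** * The maps rho *)

Lemma mulT_act n a b : (0 < n)%N ->
  mulT (lact a (ract (xzy n) b)) = xH * b * zH ^+ n.-1 * a * yH.
Proof.
have assoc (A : pzRingType) (u v w z t : A) :
    u * v * (w * (z * t)) = u * v * w * z * t by rewrite !mulrA.
case: n => // n _; rewrite ract_tens lact_tens mulT_tens.
rewrite big_ord_recl big_ord_recr /=.
rewrite !tnth_mktuple /=; have -> : lift ord0 ord_max == ord_max :> 'I_n.+2.
  exact/eqP/val_inj.
apply: etrans (assoc _ _ _ _ _ _); congr (_ * (_ * _)).
rewrite -[n in RHS]card_ord -prodr_const; apply: eq_bigr => i _.
rewrite !tnth_mktuple; case: eqP => // /(congr1 val) /= /eqP.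
by rewrite /bump leq0n add1n eqSS ltn_eqF.
Qed.

Lemma mulTD k (T1 T2 : tensH k) : mulT (T1 + T2) = mulT T1 + mulT T2.
Proof. by have := mulT_lin 1 T1 T2; rewrite !scale1r. Qed.

Lemma mulTN k (T : tensH k) : mulT (- T) = - mulT T.
Proof. exact: raddfN. Qed.

Lemma CD n f g : C n (f + g) = C n f + C n g.
Proof. exact: raddfD. Qed.

(** With two tensor factors both actions insert a at the same place: w1 a w2. *)
Lemma mulT_lact_ract (T : tensH 2) a : mulT (lact a T) = mulT (ract T a).
Proof.
move: T; apply: tensH_ext => [c f g|c f g|t].
- by rewrite lact_linr mulT_lin.
- by rewrite ract_linl mulT_lin.
move: a; apply: frakH_ext => [c f g|c f g|u].
- by rewrite lact_linl mulT_lin.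
- by rewrite ract_linr mulT_lin.
rewrite lact_mono ract_mono !mulT_mono !big_ord_recl !big_ord0 !tnth_mktuple /=.
by rewrite !mulm1 mulmA.
Qed.

Lemma ractN n (T : tensH n.+1) b : ract (- T) b = - ract T b.
Proof. by apply/eqP; rewrite -addr_eq0 -ractD addNr ract0. Qed.

Definition cycC (w b : frakH) : frakH := mulT (ract (C 1 w) b).

Lemma mulT_ract_xzy b : mulT (ract (xzy 1) b) = xH * b * yH.
Proof.
have clean (A : pzRingType) (u v w t : A) :
    u * v * t ^+ 1.-1 * 1 * w = u * v * w by rewrite expr0 !mulr1.
apply: etrans (congr1 (@mulT 2) (esym (lact1 _))) _.
exact: etrans (mulT_act _ _ (ltn0Sn 0)) (clean _ _ _ _ _).
Qed.

Lemma mulT_ract_lact (T : tensH 2) u b :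
  mulT (ract (lact u T) b) = mulT (ract T (b * u)).
Proof.
apply: etrans (congr1 (@mulT 2) (esym (lact_ract _ _ _))) _.
apply: etrans (mulT_lact_ract _ _) _.
exact: congr1 (esym (ractM _ _ _)).
Qed.

Lemma cyclic_derivation_C : cyclic_derivation xH yH cycC.
Proof.
split=> [u v b|u v b|b|b].
- by rewrite /cycC CD ractD mulTD.
- transitivity (mulT (ract (ract (C 1 u) v + lact u (C 1 v)) b)).
    congr (mulT (ract _ b)); exact: C_mul.
  apply: etrans (congr1 (@mulT 2) (ractD _ _ _)) _.
  apply: etrans (mulTD _ _) _.
  apply: (f_equal2 +%R).
    exact: congr1 (esym (ractM _ _ _)).
  exact: mulT_ract_lact.
- by rewrite /cycC C_x mulT_ract_xzy.
- by rewrite /cycC C_y ractN mulTN mulT_ract_xzy.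
Qed.

Lemma lactN n (T : tensH n.+1) a : lact a (- T) = - lact a T.
Proof. by apply/eqP; rewrite -addr_eq0 -lactD addNr lact0. Qed.

(** After multiplication the middle factors z^(n-1) stand directly before a, so they can be absorbed
    into the argument acting on C_1. *)
Lemma mulT_lact_Cword n (s : seq bool) a : (0 < n)%N ->
  mulT (lact a (Cword n s)) = mulT (ract (Cword 1 s) (zH ^+ n.-1 * a)).
Proof.
have assoc (A : pzRingType) (u v w t x : A) :
    u * v * w * t * x = u * (v * (w * t)) * x by rewrite !mulrA.
move=> n_gt0; elim: s a => [|b s IH] a.
  rewrite [Cword n _]/= [Cword 1 _]/= lact0 ract0.
  by apply: etrans (esym _); exact: raddf0.
rewrite [Cword n _]/= [Cword 1 _]/=.
apply: etrans (congr1 (@mulT _) (lactD _ _ _)) _; apply: etrans (mulTD _ _) _.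
apply: esym; apply: etrans (congr1 (@mulT _) (ractD _ _ _)) _.
apply: etrans (mulTD _ _) (esym _); apply: (f_equal2 +%R).
  have x_case : mulT (lact a (ract (xzy n) (mono (FMonom s)))) =
      mulT (ract (ract (xzy 1) (mono (FMonom s))) (zH ^+ n.-1 * a)).
    apply: etrans (mulT_act _ _ n_gt0) _; apply: etrans (assoc _ _ _ _ _ _) _.
    apply: etrans (esym (mulT_ract_xzy _)) _.
    exact: congr1 (ractM _ _ _).
  case: b; last exact: x_case.
  by rewrite !ractN lactN !mulTN; apply: congr1.
(* The letter acting on the left merges into a, which is why the induction keeps a general. *)
apply: etrans (congr1 (@mulT _) (esym (lactM _ _ _))) _.
apply: etrans (IH _) (esym _); apply: etrans (mulT_ract_lact _ _ _) _.
by congr (mulT (ract _ _)); apply: esym; apply: mulrA.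
Qed.

Lemma rho_cycC n w : (0 < n)%N -> rho n w = cycC (w * zH ^+ n.-1) 1.
Proof.
move=> n_gt0; apply: esym.
apply: etrans (cycD_MzX cyclic_derivation_C _ _) (esym _).
move: w; apply: frakH_ext => [c f g|c f g|w].
- by rewrite /rho C_lin mulT_lin.
- by rewrite /cycC C_lin ract_linl mulT_lin.
rewrite /rho /cycC !C_mono -[Cword n w]lact1.
apply: etrans (mulT_lact_Cword _ _ n_gt0) _.
by congr (mulT (ract _ _)); apply: mulr1.
Qed.

(** * Vanishing of Z on words containing both letters *)

Section Kernel.
Context (R : realType).

Lemma Z_is_zmod_morphism : zmod_morphism (Z R).
Proof. exact: mmapB. Qed.

HB.instance Definition _ :=
  GRing.isZmodMorphism.Build frakH R (Z R) Z_is_zmod_morphism.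

Lemma Z_scale c f : Z R (c *: f) = ratr c * Z R f.
Proof.
rewrite /Z (mmapEw (msuppZ_le _ _)) mmapE.
rewrite mulr_sumr; apply: eq_bigr => k _.
by rewrite mcoeffZ /= rmorphM -mulrA.
Qed.

Lemma Z_cycC_index_word s : all (leq 1) s -> has (leq 2) s ->
  Z R (cycC (index_word xH yH s) 1) = 0.
Proof.
move=> s_ge1 s_ge2; apply: etrans (cyclic_sum_formula R s_ge1 s_ge2).
apply: etrans (congr1 (Z R) (cycD_index_word cyclic_derivation_C s_ge1)) _.
apply: etrans (raddf_sum _ _ _ _) _.
apply: eq_big_nat => i /andP[_ lt_is].
apply: etrans (raddf_cyclic_form (Z R) _ _) _.
apply: eq_cyclic_form => [||t t_ge1].
- by rewrite -size_eq0 size_rot -lt0n (leq_ltn_trans _ lt_is).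
- by rewrite (eq_all_r (mem_rot _ _)).
- exact: Z_word.
Qed.

(** Read from the left: prepending y adds an entry 1, and prepending x raises the first entry,
    making it at least 2. Nonemptiness provides the entry to raise. *)
Lemma mono_index_word (s : seq bool) : exists ks : seq nat,
  [/\ ks != [::], all (leq 1) ks, false \in s -> has (leq 2) ks &
      mono (FMonom (rcons s true)) = index_word xH yH ks].
Proof.
have cons1 (A : pzRingType) (x y : A) (ks : seq nat) :
    y * index_word x y ks = index_word x y (1%N :: ks).
  by rewrite /index_word big_cons mul1r.
have consS (A : pzRingType) (x y : A) (k : nat) (ks : seq nat) : (0 < k)%N ->
    x * index_word x y (k :: ks) = index_word x y (k.+1 :: ks).
  by case: k => // k _; rewrite /index_word !big_cons !mulrA -exprS.
have nil (A : pzRingType) (x y : A) : y = index_word x y [:: 1%N].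
  by rewrite /index_word big_seq1 mul1r.
elim: s => [|[] s [[|k ks] [// _ ks_ge1 ks_ge2 sE]]].
- exists [:: 1%N]; split=> //; apply: etrans (nil _ _ _).
  by rewrite /yH fmuE.
- exists [:: 1%N, k & ks]; split=> //.
  apply: etrans (cons1 _ _ _ _); rewrite -sE rcons_cons word_cons.
  exact: mono_mul.
- case/andP: ks_ge1 => k_gt0 ks_ge1; exists (k.+1 :: ks); split=> //=.
    by rewrite ltnS k_gt0.
  apply: etrans (consS _ _ _ _ _ k_gt0).
  rewrite -sE word_cons; exact: mono_mul.
Qed.

Lemma Z_cycC_mixed (w : word) : true \in letters w -> false \in letters w ->
  Z R (cycC (mono w) 1) = 0.
Proof.
case: w => s /= sT sF.
(* Cut after some y and rotate, so that the word ends in y and has an index. *)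
have [s1 [s2 sE]] : exists s1 s2, s = rcons s1 true ++ s2.
  by case/splitPr: sT => s1 s2; exists s1, s2; rewrite cat_rcons.
have -> : cycC (mono (FMonom s)) 1 =
    cycC (mono (FMonom (rcons (s2 ++ s1) true))) 1.
  rewrite sE rcons_cat !word_cat !mono_mul.
  exact: (cycD_comm cyclic_derivation_C).
have [ks [_ ks_ge1 ks_ge2 ->]] := mono_index_word (s2 ++ s1).
apply: Z_cycC_index_word => //; apply: ks_ge2; move: sF.
by rewrite sE !mem_cat mem_rcons in_cons orbC.
Qed.

Lemma Z_cycC_mixed_zX k (w : word) :
  true \in letters w -> false \in letters w ->
  Z R (cycC (mono w * zH ^+ k) 1) = 0.
Proof.
have expand l (A : pzRingType) (u x y : A) :
    u * (x + y) ^+ l.+1 = u * x * (x + y) ^+ l + u * y * (x + y) ^+ l.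
  by rewrite exprS mulrA mulrDr mulrDl.
elim: k w => [|k IH] w wT wF.
  apply: etrans (Z_cycC_mixed wT wF); congr (Z R (cycC _ 1)); exact: mulr1.
apply: etrans (congr1 (fun f => Z R (cycC f 1)) (expand k _ (mono w) xH yH)) _.
apply: etrans (congr1 (Z R) (cycDD cyclic_derivation_C _ _ _)) _.
apply: etrans (raddfD _ _ _) _; rewrite -[RHS]addr0; apply: (f_equal2 +%R).
  apply: etrans (congr1 (fun f => Z R (cycC (f * _) 1))
    (esym (mono_mul w (fmu false)))) _.
  by apply: IH; rewrite [letters _]fmM mem_cat ?wT ?wF.
apply: etrans (congr1 (fun f => Z R (cycC (f * _) 1))
  (esym (mono_mul w (fmu true)))) _.
by apply: IH; rewrite [letters _]fmM mem_cat ?wT ?wF.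
Qed.

End Kernel.

(** * Image in xHy, and the words spanning the domain *)

Lemma cycC_form (w : word) b : exists h, cycC (mono w) b = xH * h * yH.
Proof.
case: w => s; elim: s b => [|l s IH] b.
  exists 0; rewrite -fmoneE; apply: etrans (cycD1 cyclic_derivation_C b) _.
  by rewrite mulr0 mul0r.
have {IH} [h hE] := IH (b * mono (fmu l)).
rewrite word_cons; set m := mono (FMonom s) in hE *.
have factor (A : pzRingType) (u v w t : A) :
    u * v * t + u * w * t = u * (v + w) * t.
  by rewrite mulrDr mulrDl.
have [h' h'E] : exists h', cycC (mono (fmu l)) (m * b) = xH * h' * yH.
  case: l {hE}.
    exists (- (m * b)); apply: etrans (cycD_y cyclic_derivation_C _) _.
    by rewrite mulrN mulNr.
  by exists (m * b); apply: (cycD_x cyclic_derivation_C).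
exists (h' + h); apply: etrans (factor _ _ _ _ _).
apply: etrans (congr1 (cycC^~ b) (mono_mul _ _)) _.
apply: etrans (cycDM cyclic_derivation_C _ _ _) _.
exact: (f_equal2 +%R h'E hE).
Qed.

Lemma rho_form n (w : word) : (0 < n)%N ->
  exists h, rho n (mono w) = xH * h * yH.
Proof.
move=> n_gt0; have [h hE] := cycC_form w (zH ^+ n.-1); exists h.
apply: etrans (rho_cycC _ n_gt0) _.
exact: etrans (cycD_MzX cyclic_derivation_C _ _) hE.
Qed.

Lemma mono_nseq (b : bool) k : mono (FMonom (nseq k b)) = mono (fmu b) ^+ k.
Proof.
elim: k => [|k IH]; first by rewrite -fmoneE.
rewrite exprS -IH [nseq _ _]/= word_cons; exact: mono_mul.
Qed.

Lemma mcoeff_mul_yH (w : word) (h : frakH) :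
  true \notin letters w -> (h * yH)@_w = 0.
Proof.
move=> wT; elim/malg_basis_ind: h => [|c k g IH].
  by apply: etrans (congr1 (mcoeff w) (mul0r _)) _; rewrite mcoeff0.
apply: etrans (congr1 (mcoeff w) (mulr_linl _ _ _ _)) _.
apply: etrans (mcoeffD _ _ _) _.
apply: etrans (congr2 +%R (mcoeffZ _ _ _) IH) _.
rewrite addr0.
apply: etrans (congr1 (fun f : frakH => c * f@_w) (esym (mono_mul _ _))) _.
rewrite mcoeffU; case: eqP => [wE|_]; last by rewrite mulr0.
by rewrite -wE [letters _]fmM mem_cat fmU mem_seq1 orbT in wT.
Qed.

Lemma letters_H1check (w : word) : H1 (mono w) ->
  (forall k, mono w <> yH ^+ k) -> true \in letters w /\ false \in letters w.
Proof.
move=> [c [h wE]] w_neq; split.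
  (* Compare coefficients of w in w = c + hy: without a y in w, hy contributes nothing, and neither
     does c because w differs from 1 = y^0. *)
  apply/negPn/negP => wT; have /(congr1 (mcoeff w)) := wE.
  rewrite mcoeffUU mcoeffD mcoeff_mul_yH // addr0 mcoeffZ.
  have -> : (1 : frakH)@_w = 0.
    rewrite -mono1 mcoeffU; case: eqP => // w1.
    by case: (w_neq 0); rewrite -w1.
  by rewrite mulr0 => /eqP; rewrite oner_eq0.
(* A word without x is the power of y given by its length. *)
apply/negPn/negP => wF; case: (w_neq (size (letters w))).
apply: etrans (mono_nseq true _); congr mono; case: w wF {wE w_neq} => s /= sF.
congr FMonom; elim: s sF => //= -[] s IH //; rewrite in_cons /= => /IH {1}->.
by [].
Qed.

Lemma rho_is_linear n : linear (rho n).
Proof. by move=> c f g; rewrite /rho C_lin mulT_lin. Qed.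

HB.instance Definition _ n :=
  GRing.isLinear.Build rat frakH frakH *:%R (rho n) (@rho_is_linear n).

Theorem theorem2p1 (R : realType) (n : nat) (n_gt0 : (0 < n)%N) :
  rho n @` H1check `<=` kerZ R.
Proof.
move=> _ [_ [s [c [sP ->]]] <-].
have rhoE : rho n (\sum_(w <- s) c w *: mono w) =
    \sum_(w <- s) c w *: rho n (mono w).
  apply: etrans (raddf_sum _ _ _ _) _; apply: eq_bigr => w _; exact: linearZ.
rewrite rhoE {rhoE}; split.
  suff [h ->] : exists h, \sum_(w <- s) c w *: rho n (mono w) = xH * h * yH.
    (* Membership in H^0 with constant term 0. *)
    by exists 0, h; rewrite scale0r add0r.
  elim: s {sP} => [|w s [h hE]].
    by exists 0; rewrite big_nil mulr0 mul0r.
  have [h' h'E] := rho_form w n_gt0.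
  exists (c w *: h' + h); rewrite big_cons hE h'E.
  by rewrite mulr_linr mulr_linl.
apply: etrans (raddf_sum _ _ _ _) _; rewrite big_seq big1 // => w /sP[w1 wy].
have [wT wF] := letters_H1check w1 wy.
apply: etrans (Z_scale _ _ _) _.
by rewrite rho_cycC // Z_cycC_mixed_zX // mulr0.
Qed.
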